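(* There exist absolute constants $C_0, C>0$ such that for all integers $\Delta \ge 3$ and $n \ge C_0\, \Delta \log \Delta$, there exists a finite simple graph $G=(V,E)$ with no isolated vertices such that $\tfrac12 n \le |V| \le 2n$, the maximum degree $\Delta(G)$ of $G$ satisfies $\tfrac12 \Delta \le \Delta(G) \le 2\Delta$, and $$\Upsilon(G) \le C\,\frac{n \log\log \Delta}{\log \Delta}.$$
   Context: For a finite simple graph $G=(V,E)$ and a subset $V' \subset V$, let $U(V')$ denote the set of vertices $v\in V$ of $G$ (whether or not $v$ lies in $V'$) that have a unique neighbor in $V'$, i.e. exactly one neighbor in $V'$. Define $\Upsilon(G) = \max\{ |U(V')| : V' \subset V\}$. An isolated vertex is a vertex of degree $0$. Here $\log$ is the natural logarithm. *)

(* Defs.v *)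
From mathcomp Require Import all_boot.

Set Implicit Arguments.
Unset Strict Implicit.
Unset Printing Implicit Defensive.

Record sgraph := SGraph {
  vertex :> finType;
  adj : rel vertex;
  adj_sym : symmetric adj;
  adj_irr : irreflexive adj }.

Section Graph.
Variable G : sgraph.

Definition nbrs (v : G) : {set G} := [set w | adj v w].

Definition deg (v : G) : nat := #|nbrs v|.

Definition isolated (v : G) : bool := deg v == 0.

Definition max_deg : nat := \max_(v : G) deg v.

(* v ranges over all vertices, including those of V' itself. *)
Definition unique_nbr (V' : {set G}) : {set G} :=
  [set v | #|nbrs v :&: V'| == 1].

Definition Upsilon : nat := \max_(V' : {set G}) #|unique_nbr V'|.

End Graph.

(* Main.v *)
Require Import Defs.
From HB Require Import structures.
From mathcomp Require Import all_boot all_order all_algebra.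
From mathcomp Require Import reals exp.
From mathcomp Require Import finfield.
From mathcomp Require Import zify ring lra.

(** The graph is a disjoint union of copies of one dense bipartite core, plus
    one star [K_{1,Delta}] whose only purpose is to fix the maximum degree.

    The core has a small side [A] and a side [B] split into [m] classes of
    equal size, [m] of order [ln Delta]; a vertex of class [i] has [2 ^ i]
    neighbours in [A].  Since the graph is bipartite, which vertices of [B]
    have a unique neighbour in [V'] depends only on [T], the trace of [V'] on
    [A].  If the classes behave like random graphs, a vertex of class [i] sees
    about [x_i = 2 ^ i * #|T| / #|A|] elements of [T], and it sees exactly one
    with noticeable probability only when [x_i] is of order 1.  As the [x_i]
    double from one class to the next, only a bounded number of classes, in a
    weighted sense, contribute: about a fraction [1 / m] of [B] has a unique
    neighbour, for every choice of [T].

    Randomness is not needed, because the argument uses second moments only,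
    and pairwise independence can be had exactly.  Let [A] be a finite field
    with [q = 2 ^ m] elements, fix [S_i] of size [2 ^ i] in it, and index the
    class [i] by the affine maps [a |-> x * a + y], such a map being adjacent
    to the points that it sends into [S_i].  Distinct points have uniform and
    independent images under a uniform pair [(x, y)], so the number of
    neighbours in [T] has mean [x_i] and variance at most [x_i].  By Markov and
    Chebyshev, the proportion of maps with exactly one neighbour in [T] is at
    most [x_i] ([unique_hits_small]), and at most [4 / x_i] once [x_i >= 2]
    ([unique_hits_large]).  Two geometric series bound the sum of these
    proportions by 8 ([dyadic_sum_le]).  The maps with [x = 0] are removed from
    the graph, for some of them would be isolated; removing them can only
    decrease the number of vertices of [B] with a unique neighbour.

    A core thus has about [m * q ^ 2] vertices, degrees at most [q ^ 2], and
    [Upsilon] at most [9 * q ^ 2] ([exists_core]): a fraction of order [1 / m].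
    Choosing [q ^ 2] of order [Delta] gives [m] of order [ln Delta], a core of
    order [Delta * ln Delta], and hence room for copies filling the [n]
    vertices up to a constant factor.  This gives [Upsilon] of order
    [n / ln Delta], which is stronger than required, since
    [ln (ln Delta) >= ln (ln 3) > 0]. *)

Set Implicit Arguments.
Unset Strict Implicit.
Unset Printing Implicit Defensive.

Import Order.TTheory GRing.Theory Num.Theory.
Local Open Scope ring_scope.

(** * Degrees and unique neighbours *)

Lemma deg_le_max_deg (G : sgraph) (v : G) : (deg v <= max_deg G)%N.
Proof. exact: leq_bigmax. Qed.

Lemma max_deg_le (G : sgraph) d :
  (forall v : G, deg v <= d)%N -> (max_deg G <= d)%N.
Proof. by move=> degd; apply/bigmax_leqP => v _. Qed.

Lemma unique_nbr_le_Upsilon (G : sgraph) (V' : {set G}) :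
  (#|unique_nbr V'| <= Upsilon G)%N.
Proof. exact: (leq_bigmax (F := fun V' : {set G} => #|unique_nbr V'|)). Qed.

Lemma Upsilon_le_card (G : sgraph) : (Upsilon G <= #|G|)%N.
Proof. by apply/bigmax_leqP => V' _; apply: max_card. Qed.

(** * Disjoint unions and copies *)

Section DisjointUnion.
Variables G H : sgraph.

Definition dunion_adj (u v : G + H) : bool :=
  match u, v with
  | inl x, inl y => adj x y
  | inr x, inr y => adj x y
  | _, _ => false
  end.

Fact dunion_adj_sym : symmetric dunion_adj.
Proof. by case=> x [] y //=; apply: adj_sym. Qed.

Fact dunion_adj_irr : irreflexive dunion_adj.
Proof. by case=> x /=; apply: adj_irr. Qed.

Definition dunion : sgraph := SGraph dunion_adj_sym dunion_adj_irr.

Lemma nbrs_dunionl (x : G) : nbrs (inl x : dunion) = inl @: nbrs x.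
Proof.
apply/setP=> -[y|y]; rewrite inE /=.
  by rewrite (mem_imset _ _ inl_inj) inE.
by apply/esym/imsetP => -[].
Qed.

Lemma nbrs_dunionr (x : H) : nbrs (inr x : dunion) = inr @: nbrs x.
Proof.
apply/setP=> -[y|y]; rewrite inE /=.
  by apply/esym/imsetP => -[].
by rewrite (mem_imset _ _ inr_inj) inE.
Qed.

Lemma deg_dunionl (x : G) : deg (inl x : dunion) = deg x.
Proof. by rewrite /deg nbrs_dunionl card_imset //; apply: inl_inj. Qed.

Lemma deg_dunionr (x : H) : deg (inr x : dunion) = deg x.
Proof. by rewrite /deg nbrs_dunionr card_imset //; apply: inr_inj. Qed.

Lemma Upsilon_dunion : (Upsilon dunion <= Upsilon G + Upsilon H)%N.
Proof.
apply/bigmax_leqP => V' _.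
have cardI (K : finType) (f : K -> dunion) (A : {set K}) : injective f ->
    #|(f @: A) :&: V'| = #|A :&: f @^-1: V'|.
  move=> f_inj; rewrite -(card_imset _ f_inj); apply: eq_card => z.
  rewrite inE; apply/andP/imsetP => [[/imsetP[x xA ->] fx]|[x]].
    by exists x; rewrite // !inE xA.
  by rewrite !inE => /andP[xA fx] ->; rewrite imset_f.
have -> : unique_nbr V' = inl @: unique_nbr (inl @^-1: V')
                      :|: inr @: unique_nbr (inr @^-1: V').
  apply/setP=> -[x|x]; rewrite !inE.
    rewrite nbrs_dunionl (cardI _ _ _ inl_inj) (mem_imset _ _ inl_inj) inE.
    by rewrite [X in _ || X](_ : _ = false) ?orbF //; apply/imsetP => -[].
  rewrite nbrs_dunionr (cardI _ _ _ inr_inj) (mem_imset _ _ inr_inj) inE.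
  by rewrite [X in X || _](_ : _ = false) //; apply/imsetP => -[].
rewrite cardsU (leq_trans (leq_subr _ _)) //.
by rewrite leq_add // (leq_trans (leq_imset_card _ _)) ?unique_nbr_le_Upsilon.
Qed.

End DisjointUnion.

Lemma card_set_slices (I K : finType) (P : I * K -> bool) :
  #|[set u | P u]| = (\sum_i #|[set k | P (i, k)]|)%N.
Proof.
under eq_bigr => i _ do rewrite -sum1_card.
rewrite pair_big_dep -sum1_card /=.
by apply: eq_bigl => -[i k]; rewrite !inE.
Qed.

Section Copies.
Variables (N : nat) (G : sgraph).

Definition copies_adj (u v : 'I_N * G) : bool :=
  (u.1 == v.1) && adj u.2 v.2.

Fact copies_adj_sym : symmetric copies_adj.
Proof. by move=> u v; rewrite /copies_adj eq_sym adj_sym. Qed.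

Fact copies_adj_irr : irreflexive copies_adj.
Proof. by move=> u; rewrite /copies_adj adj_irr andbF. Qed.

Definition copies : sgraph := SGraph copies_adj_sym copies_adj_irr.

Lemma nbrs_copies (j : 'I_N) (x : G) :
  nbrs ((j, x) : copies) = pair j @: nbrs x.
Proof.
apply/setP=> -[k y]; rewrite inE /= /copies_adj /=.
apply/andP/imsetP => [[/eqP <- xy]|[z]]; first by exists y; rewrite ?inE.
by rewrite inE => xz [-> ->].
Qed.

Lemma deg_copies (u : copies) : deg u = deg u.2.
Proof. by case: u => j x; rewrite /deg nbrs_copies card_imset // => y z []. Qed.

Lemma Upsilon_copies : (Upsilon copies <= N * Upsilon G)%N.
Proof.
apply/bigmax_leqP => V' _.
rewrite -[N in leqRHS]card_ord -sum_nat_const.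
rewrite [leqLHS]card_set_slices; apply: leq_sum => j _.
apply: leq_trans (unique_nbr_le_Upsilon (pair j @^-1: V')).
have pair_inj : injective (pair j : G -> copies) by move=> y z [].
apply/eq_leq/eq_card => x; rewrite !inE nbrs_copies.
congr (_ == _); rewrite -(card_imset _ pair_inj); apply: eq_card => z.
rewrite inE; apply/andP/imsetP => [[/imsetP[y xy ->] jy]|[y]].
  by exists y; rewrite // inE xy inE.
by rewrite !inE => /andP[xy jy] ->; rewrite imset_f // inE.
Qed.

End Copies.

(** * Bipartite graphs *)

Section Bipartite.
Variables (A B : finType) (r : A -> B -> bool).

Definition bip_adj (u v : A + B) : bool :=
  match u, v with
  | inl a, inr b | inr b, inl a => r a b
  | _, _ => false
  end.

Fact bip_adj_sym : symmetric bip_adj.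
Proof. by case=> x []. Qed.

Fact bip_adj_irr : irreflexive bip_adj.
Proof. by case. Qed.

Definition bip : sgraph := SGraph bip_adj_sym bip_adj_irr.

Lemma nbrs_bipl a : nbrs (inl a : bip) = inr @: [set b | r a b].
Proof.
apply/setP=> -[y|y]; rewrite inE /=.
  by apply/esym/imsetP => -[].
by rewrite (mem_imset _ _ inr_inj) inE.
Qed.

Lemma nbrs_bipr b : nbrs (inr b : bip) = inl @: [set a | r a b].
Proof.
apply/setP=> -[y|y]; rewrite inE /=.
  by rewrite (mem_imset _ _ inl_inj) inE.
by apply/esym/imsetP => -[].
Qed.

Lemma deg_bipl a : deg (inl a : bip) = #|[set b | r a b]|.
Proof. by rewrite /deg nbrs_bipl card_imset //; apply: inr_inj. Qed.

Lemma deg_bipr b : deg (inr b : bip) = #|[set a | r a b]|.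
Proof. by rewrite /deg nbrs_bipr card_imset //; apply: inl_inj. Qed.

(** A vertex on the right has all its neighbours on the left, so its status is
    determined by the left part [T] of [V']; the left side itself is counted in
    full, which costs little when it is small. *)
Lemma Upsilon_bip M :
  (forall T : {set A}, #|[set b | #|[set a in T | r a b]| == 1%N]| <= M)%N ->
  (Upsilon bip <= #|A| + M)%N.
Proof.
move=> leM; apply/bigmax_leqP => V' _; pose T := inl @^-1: V'.
have sub : unique_nbr V' \subset inl @: [set: A]
             :|: inr @: [set b | #|[set a in T | r a b]| == 1%N].
  apply/subsetP => -[a _|b]; first by rewrite inE imset_f.
  rewrite inE nbrs_bipr => /eqP cardV; rewrite inE orbC imset_f // inE -cardV.
  rewrite -(card_imset _ (@inl_inj A B)); apply/eqP/eq_card => z; rewrite inE.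
  apply/imsetP/andP => [[a]|[/imsetP[a ra ->] aV]].
    by rewrite !inE => /andP[aV ra] ->; rewrite imset_f // inE.
  by exists a; rewrite // !inE aV; rewrite inE in ra.
rewrite (leq_trans (subset_leq_card sub)) // cardsU (leq_trans (leq_subr _ _)) //.
rewrite leq_add // (leq_trans (leq_imset_card _ _)) ?cardsT //.
Qed.

End Bipartite.

(** * Affine maps hit a set pairwise independently *)

Section AffineHashing.
Variable F : finFieldType.
Variables S T : {set F}.

(** The pair [p] encodes the affine map [a |-> p.1 * a + p.2]. *)
Definition hits (p : F * F) : {set F} := [set a in T | p.1 * a + p.2 \in S].

Local Notation q := #|F|.
Local Notation U := #|[set p : F * F | #|hits p| == 1%N]|.

Lemma card_hits (p : F * F) :
  #|hits p| = (\sum_(a in T) ((p.1 * a + p.2)%R \in S))%N.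
Proof.
rewrite -sum1_card big_mkcond [RHS]big_mkcond /=; apply: eq_bigr => a _.
by rewrite inE; case: (a \in T) => //=; case: (_ \in S).
Qed.

Lemma card_affine_translate (c : F) :
  (\sum_(y : F) ((c + y)%R \in S) = #|S|)%N.
Proof.
rewrite (reindex_inj (addrI (- c))) /= -sum1_card [RHS]big_mkcond.
by apply: eq_bigr => y _; rewrite addrA subrr add0r; case: (_ \in S).
Qed.

Lemma card_affine_point (a : F) :
  (\sum_(p : F * F) ((p.1 * a + p.2)%R \in S) = q * #|S|)%N.
Proof.
rewrite -(pair_bigA _ (fun x y : F => ((x * a + y)%R \in S : nat))) /=.
rewrite -sum_nat_const; apply: eq_bigr => x _.
exact: card_affine_translate.
Qed.

(** This is the exact pairwise independence: a pair [(x, y)] is determined by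
    the images of two distinct points, and these images are arbitrary. *)
Lemma card_affine_pair (a b : F) : a != b ->
  (\sum_(p : F * F) ((p.1 * a + p.2)%R \in S) * ((p.1 * b + p.2)%R \in S)
     = #|S| * #|S|)%N.
Proof.
move=> neq_ab; pose f (p : F * F) := (p.1 * a + p.2, p.1 * b + p.2).
have f_inj : injective f.
  move=> [x y] [x' y'] [/= ea eb].
  have /eqP : (x - x') * (a - b) = 0.
    transitivity ((x * a + y) - (x * b + y) - ((x' * a + y') - (x' * b + y'))).
      by ring.
    by rewrite ea eb subrr.
  rewrite mulf_eq0 (subr_eq0 a) (negPf neq_ab) orbF subr_eq0 => /eqP ex.
  by move: ea; rewrite ex => /addrI ->.
transitivity (\sum_(p : F * F) (p.1 \in S) * (p.2 \in S))%N.
  by rewrite [RHS](reindex_inj f_inj).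
rewrite -(pair_bigA _ (fun x y : F => ((x \in S) * (y \in S))%N)) /=.
rewrite -big_distrlr /=.
by rewrite (_ : (\sum_x (x \in S) = #|S|)%N) // -sum1_card [RHS]big_mkcond.
Qed.

Lemma first_moment : (\sum_(p : F * F) #|hits p| = #|T| * (q * #|S|))%N.
Proof.
under eq_bigr => p _ do rewrite card_hits.
rewrite exchange_big /= -sum_nat_const; apply: eq_bigr => a _.
exact: card_affine_point.
Qed.

Lemma second_moment : (\sum_(p : F * F) #|hits p| ^ 2 =
  #|T| * (q * #|S|) + #|T| * (#|T| - 1) * (#|S| * #|S|))%N.
Proof.
under eq_bigr => p _ do rewrite -mulnn card_hits big_distrlr /=.
rewrite exchange_big /= -mulnA -mulnDr -sum_nat_const; apply: eq_bigr => a aT.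
rewrite exchange_big /= (bigD1 a) //=; congr (_ + _)%N.
  rewrite -(card_affine_point a); apply: eq_bigr => p _.
  by case: (_ \in S).
rewrite (eq_bigr (fun=> #|S| * #|S|)%N); last first.
  by move=> b /andP[_ ba]; rewrite -(card_affine_pair (b := b) (a := a)) // eq_sym.
rewrite sum_nat_const; congr (_ * _)%N.
rewrite (cardsD1 a T) aT addKn; apply: eq_card => b.
by rewrite !inE andbC.
Qed.

(** Markov's inequality. *)
Lemma unique_hits_small : (U <= #|T| * (q * #|S|))%N.
Proof.
rewrite -first_moment -sum1_card big_mkcond leq_sum // => p _.
by rewrite inE; case: eqP => // ->.
Qed.

(** Chebyshev's inequality, multiplied out.  With [x = #|T| * #|S|], the number
    of hits has mean [x / q] and variance at most [x / q], and a single hit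
    deviates from the mean by [x / q - 1], which is at least half the mean by
    hypothesis. *)
Lemma unique_hits_large : (2 * q <= #|T| * #|S|)%N ->
  (U * (#|T| * #|S|) <= 4 * q ^ 3)%N.
Proof.
move=> large; set x := (#|T| * #|S|)%N in large *.
have chebyshev : (U%:Z * (x%:Z - q%:Z) ^+ 2 <= q%:Z ^+ 3 * x%:Z).
  have : U%:Z * (x%:Z - q%:Z) ^+ 2
      <= \sum_(p : F * F) (q%:Z * #|hits p|%:Z - x%:Z) ^+ 2.
    rewrite -sum1_card big_mkcond /= (big_morph Posz PoszD (erefl _)) big_distrl /=.
    apply: ler_sum => p _; rewrite inE; case: eqP => [->|_].
      by rewrite mul1r mulr1 -sqrrN opprB.
    by rewrite mul0r sqr_ge0.
  move=> /le_trans; apply.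
  (* Only the moments of [#|hits p|] enter the expansion of the square, and
     the variance term is [q ^ 2 * (q * x - #|T| * #|S| ^ 2)]. *)
  rewrite (eq_bigr (fun p : F * F => q%:Z ^+ 2 * (#|hits p| ^ 2)%N%:Z
      - 2 * q%:Z * x%:Z * #|hits p|%:Z + x%:Z ^+ 2)); last first.
    by move=> p _; rewrite -mulnn PoszM; ring.
  rewrite big_split /= sumrB -!big_distrr /= -!(big_morph Posz PoszD (erefl _)).
  rewrite first_moment second_moment sumr_const card_prod -mulr_natl natz.
  move: large; rewrite /x; case: #|T| => [|t]; first by rewrite !mul0n; nia.
  rewrite subn1 /= => _; nia.
have [->|x_gt0] := posnP x; first by rewrite muln0.
rewrite -(leq_pmul2r x_gt0) -lez_nat !PoszM.
apply: le_trans (_ : 4 * (q%:Z ^+ 3 * x%:Z) <= _); last first.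
  by rewrite !exprS expr0 -!PoszM; lia.
apply: le_trans (ler_wpM2l (ler0n _ 4) chebyshev).
by rewrite [leRHS]mulrCA -[leLHS]mulrA; apply: ler_wpM2l => //; nia.
Qed.

End AffineHashing.

(** Sum of the two bounds over the scales.  With [x_i = t * 2 ^ i / q] they read
    [u i <= q ^ 2 * x_i] and, when [x_i >= 2], [u i <= 4 * q ^ 2 / x_i]. *)
Lemma dyadic_sum_le (q t : nat) (u : nat -> nat) :
  (forall i, u i <= q * (t * 2 ^ i))%N ->
  (forall i, 2 * q <= t * 2 ^ i -> u i * (t * 2 ^ i) <= 4 * q ^ 3)%N ->
  forall m, (\sum_(i < m) u i <= 8 * q ^ 2)%N.
Proof.
move=> small large m.
(* Geometric series telescope: the partial sum up to [m] stays below
   [q ^ 2 * x_m] as long as [x_m < 2], and below [8 * q ^ 2 * (1 - 1 / x_m)]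
   afterwards.  At the crossing, where [2 <= x_m < 4], the first bound is at
   most [4 * q ^ 2] and the second at least that. *)
suff : (if t * 2 ^ m < 2 * q then \sum_(i < m) u i <= q * (t * 2 ^ m)
  else (\sum_(i < m) u i) * (t * 2 ^ m) + 8 * q ^ 3 <= 8 * q ^ 2 * (t * 2 ^ m))%N.
  case: ltnP => [lt_y le_P|le_y le_P]; first by nia.
  have [q0|q_gt0] := posnP q.
    rewrite big1 // => i _; apply/eqP; rewrite -leqn0.
    by move: (small i); rewrite q0 mul0n.
  have y_gt0 : (0 < t * 2 ^ m)%N by lia.
  by rewrite -(leq_pmul2r y_gt0); lia.
elim: m => [|m IHm]; first by rewrite big_ord0 expn0 muln1; case: ltnP; nia.
rewrite big_ord_recr /=; set P := (\sum_(i < m) u i)%N in IHm *.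
move: (small m) (large m) IHm; rewrite (expnS 2 m) (mulnCA t 2%N).
move: (t * 2 ^ m)%N => y; move: (u m) => v {}small {}large.
have [lt_y|le_y] := ltnP y (2 * q); have [lt_y2|le_y2] := ltnP (2 * y) (2 * q) => IHm.
- lia.
- nia.
- lia.
- move: (large le_y); nia.
Qed.

(** * The core graph *)

Lemma exists_set_card (K : finType) k :
  (k <= #|K|)%N -> exists S : {set K}, #|S| = k.
Proof.
move=> le_k; exists [set x in take k (enum K)].
rewrite cardsE; have /card_uniqP -> : uniq (take k (enum K)).
  by rewrite take_uniq ?enum_uniq.
by rewrite size_takel // -cardE.
Qed.

Section Core.
Variables (F : finFieldType) (m : nat) (S : 'I_m -> {set F}).
Hypothesis m_gt0 : (0 < m)%N.
Hypothesis cardF : #|F| = (2 ^ m)%N.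
Hypothesis cardS : forall i, #|S i| = (2 ^ i)%N.

Local Notation q := #|F|.

(** The multiplier ranges over the nonzero elements: a constant map is adjacent
    to all points or to none, and in the second case it would be isolated. *)
Definition core_rel (a : F) (b : 'I_m * ({x : F | x != 0} * F)) : bool :=
  val b.2.1 * a + b.2.2 \in S b.1.

Definition core : sgraph := bip core_rel.

Lemma card_core : #|core| = (q + m * ((q - 1) * q))%N.
Proof.
rewrite card_sum !card_prod card_ord card_sig.
congr (_ + _ * (_ * _))%N.
by rewrite subn1 -(cardC1 (0 : F)); apply: eq_card => x; rewrite !inE.
Qed.

(** A point meets a fraction [2 ^ i / q] of class [i], so the last class
    dominates its degree. *)
Lemma deg_core_le (v : core) : (deg v <= q ^ 2)%N.
Proof.
case: v => [a|b]; last first.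
  rewrite deg_bipr (leq_trans (max_card _)) // -mulnn leq_pmulr //.
  by rewrite cardF expn_gt0.
rewrite deg_bipl card_set_slices.
apply: (@leq_trans (\sum_(i < m) q * 2 ^ i)).
  apply: leq_sum => i _; rewrite card_set_slices /=.
  apply: (@leq_trans (\sum_(x : {x : F | x != 0}) #|S i|)).
    apply: leq_sum => x _; rewrite -(card_affine_translate (S i) (val x * a)).
    rewrite -sum1_card big_mkcond; apply: leq_sum => y _.
    by rewrite inE /core_rel /=; case: (_ \in _).
  rewrite sum_nat_const cardS leq_mul2r card_sig max_card orbT //.
rewrite -big_distrr /= -mulnn leq_mul2l; apply/orP; right.
rewrite cardF; elim: (m) => [|k IHk]; first by rewrite big_ord0.
by rewrite big_ord_recr /= expnS mul2n -addnn leq_add2r.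
Qed.

Lemma core_no_isolated (v : core) : ~~ isolated v.
Proof.
rewrite /isolated -lt0n; have S_gt0 i : exists s, s \in S i.
  by apply/set0Pn; rewrite -card_gt0 cardS expn_gt0.
case: v => [a|[i [x y]]]; rewrite ?deg_bipl ?deg_bipr; apply/card_gt0P.
  have [s sS] := S_gt0 (Ordinal m_gt0).
  exists (Ordinal m_gt0, (exist _ 1 (oner_neq0 F), s - a)).
  by rewrite inE /core_rel /= mul1r addrC subrK.
have [s sS] := S_gt0 i; exists ((s - y) / val x).
by rewrite inE /core_rel /= mulrC divfK ?subrK // (valP x).
Qed.

Lemma Upsilon_core : (Upsilon core <= 9 * q ^ 2)%N.
Proof.
have q_gt0 : (0 < q)%N by rewrite cardF expn_gt0.
apply: (@leq_trans (q + 8 * q ^ 2)); last by nia.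
apply: Upsilon_bip => T; rewrite card_set_slices.
(* Extends the counts from ['I_m] to all naturals, by 0. *)
pose u i := if insub i is Some j then
  #|[set p : F * F | #|hits (S j) T p| == 1%N]| else 0%N.
apply: (@leq_trans (\sum_(i < m) u i)).
  apply: leq_sum => i _; rewrite /u valK.
  pose f (p : {x : F | x != 0} * F) := (val p.1, p.2).
  have f_inj : injective f by move=> [x y] [x' y'] [/val_inj -> ->].
  rewrite -(card_imset _ f_inj); apply/subset_leq_card/subsetP => z /imsetP[p].
  by rewrite inE => hp ->; rewrite inE.
apply: (@dyadic_sum_le _ #|T|) => i; rewrite /u; case: insubP => //= j _ <-.
  by rewrite -cardS mulnCA unique_hits_small.
by rewrite -cardS; apply: unique_hits_large.
Qed.

End Core.

Lemma exists_core m : (0 < m)%N -> exists G : sgraph,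
  [/\ forall v : G, ~~ isolated v,
      #|G| = (2 ^ m + m * ((2 ^ m - 1) * 2 ^ m))%N,
      forall v : G, (deg v <= (2 ^ m) ^ 2)%N
    & (Upsilon G <= 9 * (2 ^ m) ^ 2)%N].
Proof.
move=> m_gt0; have [F _ cardF] := pPrimePowerField (erefl (prime 2)) m_gt0.
have [S cardS] : exists S : 'I_m -> {set F}, forall i, #|S i| = (2 ^ i)%N.
  have ex (i : 'I_m) : exists A : {set F}, #|A| == (2 ^ i)%N.
    have [|A <-] := @exists_set_card F (2 ^ i); last by exists A.
    by rewrite cardF leq_exp2l // ltnW.
  by exists (fun i => xchoose (ex i)) => i; apply/eqP/(xchooseP (ex i)).
exists (core S); rewrite -cardF; split.
- exact: core_no_isolated.
- exact: card_core.
- exact: deg_core_le.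
- exact: Upsilon_core.
Qed.

(** * The star *)

Definition star (d : nat) : sgraph := bip (fun (_ : unit) (_ : 'I_d) => true).

Lemma card_star d : #|star d| = d.+1.
Proof. by rewrite card_sum card_unit card_ord. Qed.

Lemma deg_star_center d : deg (inl tt : star d) = d.
Proof. by rewrite deg_bipl cardsT card_ord. Qed.

Lemma deg_star_leaf d i : deg (inr i : star d) = 1%N.
Proof. by rewrite deg_bipr cardsT card_unit. Qed.

(** * Choice of the parameters *)

Lemma core_card_bounds m q h : (0 < m)%N -> (2 <= q)%N ->
  h = (q + m * ((q - 1) * q))%N ->
  [/\ m * q ^ 2 <= 2 * h, h <= 2 * (m * q ^ 2) & 0 < h]%N.
Proof.
move=> m_gt0 q_ge2 ->; split; [|nia|nia].
apply: leq_trans (_ : 2 * (m * ((q - 1) * q)) <= _)%N; last by lia.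
rewrite mulnCA leq_mul2l; apply/orP; right; nia.
Qed.

(** Equivalently, [e < 3]: here because [ln (6 / 5) >= 1 - 5 / 6] and
    [(6 / 5) ^ 6 < 3]. *)
Lemma ln3_gt1 (R : realType) : 1 < ln (3 : R).
Proof.
have ln65 : 6^-1 <= ln (6 / 5 : R).
  have := @le_ln1Dx R (- 6^-1); rewrite (_ : 1 + - 6^-1 = (6 / 5)^-1); last by field.
  rewrite lnV ?posrE; last by lra.
  by rewrite lerN2; apply; lra.
apply: le_lt_trans (_ : ln ((6 / 5) ^+ 6 : R) < _).
  by rewrite lnXn; [rewrite -[leRHS]mulr_natl; lra | lra].
by rewrite ltr_ln ?posrE ?exprn_gt0 //; lra.
Qed.

(** The largest [m] with [4 ^ m <= 2 * Delta]; the factor 2 makes [m] positive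
    already for [Delta = 3]. *)
Lemma exists_scale_count (R : realType) (Delta : nat) : (3 <= Delta)%N ->
  exists m : nat, [/\ (0 < m)%N, ((2 ^ m) ^ 2 <= 2 * Delta)%N,
    m%:R <= 2 * ln (Delta%:R : R) & ln (Delta%:R : R) <= 6 * m%:R].
Proof.
move=> Delta_ge3; have ln3 := ln3_gt1 R.
have DeltaR : 3 <= Delta%:R :> R by rewrite ler_nat.
have ln4_le3 : ln (4 : R) <= 3.
  by have := @le_ln1Dx R 3; rewrite -natr1 addrC; apply; lra.
have ln4_ge1 : 1 <= ln (4 : R).
  by rewrite (le_trans (ltW ln3)) // ler_ln ?posrE; lra.
have ln_ge1 : 1 <= ln (Delta%:R : R).
  by rewrite (le_trans (ltW ln3)) // ler_ln ?posrE; lra.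
pose m := trunc_log 4 (2 * Delta).
have /andP[le_m gt_m] : (4 ^ m <= 2 * Delta < 4 ^ m.+1)%N.
  by apply: trunc_log_bounds; lia.
have m_gt0 : (0 < m)%N by case: (m) gt_m => //; rewrite expn1; lia.
exists m; split => //; first by rewrite -expnM mulnC expnM.
  have : ln (4 ^+ m : R) <= ln (Delta%:R ^+ 2).
    rewrite ler_ln ?posrE ?exprn_gt0 //; try lra.
    rewrite -!natrX ler_nat (leq_trans le_m) // -mulnn leq_mul2r; lia.
  rewrite !lnXn; try lra.
  rewrite -[leLHS]mulr_natl -[leRHS]mulr_natl; apply: le_trans.
  by rewrite ler_peMr.
have : ln (Delta%:R : R) <= ln (4 ^+ m.+1 : R).
  rewrite ler_ln ?posrE ?exprn_gt0 //; try lra.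
  rewrite -natrX ler_nat; lia.
rewrite lnXn; last by lra.
move=> /le_trans; apply; rewrite -[leLHS]mulr_natl -natr1.
have : 1 <= m%:R :> R by rewrite ler1n.
nra.
Qed.

(** * The final graph *)

Theorem theorem6 (R : realType) :
  exists C0 C : R, 0 < C0 /\ 0 < C /\
    forall Delta n : nat, (3 <= Delta)%N ->
      C0 * Delta%:R * ln Delta%:R <= n%:R ->
      exists G : sgraph,
        (forall v : G, ~~ isolated v) /\
        2^-1 * n%:R <= #|G|%:R :> R /\
        #|G|%:R <= 2 * n%:R :> R /\
        2^-1 * Delta%:R <= (max_deg G)%:R :> R /\
        (max_deg G)%:R <= 2 * Delta%:R :> R /\
        (Upsilon G)%:R <= C * ((n%:R * ln (ln Delta%:R)) / ln Delta%:R).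
Proof.
have ln3 := ln3_gt1 R.
have lnln3_gt0 : 0 < ln (ln (3 : R)) by rewrite ln_gt0.
(* The core has at most [8 * Delta * L] vertices with [L = ln Delta], so 16
   ensures that it fits twice into [n].  For the other constant, the copies
   contribute [9 * 12 * n / L] and the star at most [n / L]. *)
exists 16, (109 / ln (ln 3)); split=> //; split; first by rewrite divr_gt0.
move=> Delta n Delta_ge3 n_large.
have [m [m_gt0 q_le m_le L_le]] := exists_scale_count R Delta_ge3.
have [H [H_iso cardH degH UpsH]] := exists_core m_gt0.
have q_ge2 : (2 <= 2 ^ m)%N by rewrite -(expn1 2) leq_exp2l.
move: (2 ^ m)%N q_ge2 q_le cardH degH UpsH => q q_ge2 q_le cardH degH UpsH.
have cardN N : #|dunion (copies N H) (star Delta)| = (N * #|H| + Delta.+1)%N.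
  by rewrite card_sum card_star card_prod card_ord.
move: #|H| cardH cardN => h cardH cardN.
set L := ln Delta%:R in n_large m_le L_le *.
have DeltaR : 3 <= Delta%:R :> R by rewrite ler_nat.
have L_ge : ln 3 <= L by rewrite ler_ln ?posrE; lra.
have L_gt1 : 1 < L by apply: lt_le_trans L_ge.
have lnL_ge : ln (ln (3 : R)) <= ln L by rewrite ler_ln ?posrE; lra.
have [h_ge h_le h_gt0] := core_card_bounds m_gt0 q_ge2 cardH.
clear cardH.
pose N := (n %/ h)%N.
have Nh_le : (N * h <= n)%N by apply: leq_divM.
have Nh_gt : (n < N * h + h)%N by rewrite -mulSnr ltn_ceil.
have DL_ge : Delta%:R <= Delta%:R * L by rewrite ler_peMr; lra.
have h_leR : h%:R <= 8 * (Delta%:R * L).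
  have le1 : h%:R <= 4 * (m%:R * Delta%:R) :> R.
    rewrite -!natrM ler_nat (leq_trans h_le) //.
    by rewrite -[4%N]/(2 * 2)%N -mulnA (mulnCA 2%N m Delta) !leq_mul2l q_le !orbT.
  have : m%:R * Delta%:R <= 2 * L * Delta%:R :> R by rewrite ler_wpM2r.
  lra.
have Nh_leR : N%:R * h%:R <= n%:R :> R by rewrite -natrM ler_nat.
have Nh_gtR : n%:R <= N%:R * h%:R + h%:R :> R.
  by rewrite -natrM -natrD ler_nat ltnW.
exists (dunion (copies N H) (star Delta)).
rewrite cardN natrD natrM -[Delta.+1%:R]natr1; split.
  case=> v; rewrite /isolated.
    by rewrite deg_dunionl deg_copies H_iso.
  rewrite deg_dunionr; case: v => [[]|i].
    by rewrite deg_star_center -lt0n (leq_trans _ Delta_ge3).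
  by rewrite deg_star_leaf.
split; first by lra.
split; first by lra.
split.
  apply: le_trans (_ : Delta%:R <= _); first by lra.
  rewrite ler_nat.
  have := deg_le_max_deg (inr (inl tt) : dunion (copies N H) (star Delta)).
  by rewrite deg_dunionr deg_star_center.
split.
  rewrite -natrM ler_nat; apply: max_deg_le => -[u|[[]|i]].
  - by rewrite deg_dunionl deg_copies (leq_trans (degH _)).
  - by rewrite deg_dunionr deg_star_center leq_pmull.
  - by rewrite deg_dunionr deg_star_leaf muln_gt0 (leq_trans _ Delta_ge3).
have UpsG : (Upsilon (dunion (copies N H) (star Delta)) <=
    9 * (N * q ^ 2) + Delta.+1)%N.
  apply: leq_trans (Upsilon_dunion _ _) _; apply: leq_add.
    apply: leq_trans (Upsilon_copies _ _) _.
    by rewrite mulnCA leq_mul2l UpsH orbT.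
  by rewrite -card_star; apply: Upsilon_le_card.
have NqL : (N * q ^ 2)%:R * L <= 12 * n%:R.
  have le1 : (N * q ^ 2)%:R * L <= (N * q ^ 2)%:R * (6 * m%:R) by rewrite ler_wpM2l.
  apply: le_trans le1 _; rewrite -!natrM ler_nat.
  apply: leq_trans (_ : 12 * (N * h) <= _)%N; last by rewrite leq_mul2l Nh_le.
  rewrite [X in (X <= _)%N](_ : _ = 6 * N * (m * q ^ 2))%N; last by ring.
  rewrite [X in (_ <= X)%N](_ : _ = 6 * N * (2 * h))%N; last by ring.
  by rewrite leq_mul2l h_ge orbT.
apply: le_trans (_ : 109 * n%:R / L <= _).
  rewrite ler_pdivlMr; last by lra.
  apply: le_trans (_ : (9 * (N * q ^ 2) + Delta.+1)%:R * L <= _).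
    by apply: ler_wpM2r; [lra | rewrite ler_nat].
  rewrite natrD natrM -[Delta.+1%:R]natr1 mulrDl [(Delta%:R + 1) * L]mulrDl.
  have : L <= Delta%:R * L by rewrite ler_peMl; lra.
  lra.
rewrite [leRHS]mulrA ler_wpM2r ?invr_ge0; try lra.
rewrite [leRHS](_ : _ = 109 * n%:R * (ln L / ln (ln 3))); last by ring.
by rewrite ler_peMr ?mulr_ge0 // ler_pdivlMr // mul1r.
Qed.
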